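(* Let $X$ be a locally finite partially ordered set and let $Y=\{y\in X: \text{there exists } x\in \mathrm{Min}(X) \text{ with } x\le y\}$, so that $X=Y\sqcup (X\setminus Y)$. Assume that $R$ is an Artinian and nonsingular ring (with identity, not necessarily commutative), that $\mathrm{Min}(Y)$ is finite, and that $\kappa(x)$ is finite for all $x\in X$. Then $$\mathrm{Soc}_l(I(X,R))=\bigoplus_{x\in \mathrm{Min}(Y)} S(x,\mathrm{Soc}_l(R)).$$
   Context: A partially ordered set $X$ is locally finite if every interval $[x,y]=\{z\in X: x\le z\le y\}$ is finite. For a partially ordered set $P$, $\mathrm{Min}(P)$ is the set of minimal elements of $P$; $Y$ carries the order induced from $X$ (and $\mathrm{Min}(Y)=\mathrm{Min}(X)$). For $x\in X$, $\kappa(x)=|\{y\in X: x\le y\}|$. The incidence ring $I(X,R)$ is the set of functions $f:X\times X\to R$ with $f(x,y)=0$ unless $x\le y$, with pointwise addition and product $(fg)(x,y)=\sum_{x\le z\le y} f(x,z)g(z,y)$. For a left ideal $J$ of $R$, $I(X,J)$ denotes the set of $f\in I(X,R)$ all of whose values lie in $J$. For $x\in\mathrm{Min}(X)$ and a left ideal $J$ of $R$, $S(x,J)=\{f\in I(X,J): f(u,v)=0 \text{ if } u\ne x\}$; the direct sum is the internal direct sum inside $I(X,R)$. For a ring $A$, the left socle $\mathrm{Soc}_l(A)$ is the sum of all minimal left ideals of $A$. A left (right) ideal is left (right) essential if it intersects every nonzero left (right) ideal nontrivially. The left singular ideal $\mathrm{Sing}_l(A)$ is the set of $a\in A$ whose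 left annihilator is a left essential ideal, and $\mathrm{Sing}_r(A)$ is defined symmetrically; $A$ is left (right) nonsingular if $\mathrm{Sing}_l(A)=0$ ($\mathrm{Sing}_r(A)=0$). ''Artinian'' and ''nonsingular'' without qualifier mean both left and right. *)

(* Defs.v *)
From HB Require Import structures.
From mathcomp Require Import all_boot all_order all_algebra.
From mathcomp Require Import finmap boolp classical_sets functions cardinality fsbigop.

Set Implicit Arguments.
Unset Strict Implicit.
Unset Printing Implicit Defensive.

Import Order.TTheory GRing.Theory.
Local Open Scope classical_set_scope.
Local Open Scope ring_scope.

HB.mixin Record isLocallyFinite (d : Order.disp_t) (X : Type)
    of Order.POrder d X := {
  finite_interval : forall x y : X, finite_set [set z | (x <= z <= y)%O]
}.

#[short(type="lfPOrderType")]
HB.structure Definition LocallyFinitePOrder (d : Order.disp_t) :=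
  {X of isLocallyFinite d X & Order.POrder d X}.

(* [pzRingType] is an associative unital ring, possibly the zero ring, which is
   what the incidence ring over the empty poset is. *)

Section IdealTheory.
Variable A : pzRingType.
Implicit Types (a b : A) (J K M : set A).

Definition left_ideal J : Prop :=
  [/\ J 0, forall a b, J a -> J b -> J (a + b) & forall a b, J b -> J (a * b)].

Definition minimal_left_ideal M : Prop :=
  [/\ left_ideal M, M <> [set 0]
    & forall J, left_ideal J -> J `<=` M -> J = [set 0] \/ J = M].

(* The sum of a possibly infinite family of additive subgroups: all finite sums
   of elements of its members ({0} for the empty family). *)
Definition family_sum (F : set (set A)) : set A :=
  [set a | exists2 s : seq A,
     (forall b, b \in s -> exists2 J, F J & J b) & a = \sum_(b <- s) b].

Definition left_socle : set A := family_sum minimal_left_ideal.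

Definition left_essential J : Prop :=
  left_ideal J /\
  forall K, left_ideal K -> K <> [set 0] -> J `&` K <> [set 0].

Definition left_annihilator a : set A := [set b | b * a = 0].

Definition left_singular_ideal : set A :=
  [set a | left_essential (left_annihilator a)].

Definition left_nonsingular : Prop := left_singular_ideal = [set 0].

Definition left_artinian : Prop :=
  forall J : nat -> set A,
    (forall n, left_ideal (J n)) -> (forall n, J n.+1 `<=` J n) ->
    exists n, forall m, (n <= m)%N -> J m = J n.

(* Each S i meets the sum of the other members in 0; the S i are meant to be
   additive subgroups. *)
Definition direct_family (T : Type) (I : set T) (S : T -> set A) : Prop :=
  forall i, I i -> S i `&` family_sum (S @` (I `\ i)) = [set 0].

Definition internal_direct_sum (T : Type) (I : set T) (S : T -> set A)
    (B : set A) : Prop :=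
  B = family_sum (S @` I) /\ direct_family I S.

End IdealTheory.

Arguments left_socle A : clear implicits.
Arguments left_singular_ideal A : clear implicits.

(* Right-handed notions are the left-handed ones of the converse ring. *)
Definition artinian (A : pzRingType) : Prop :=
  left_artinian A /\ left_artinian A^c.

Definition nonsingular (A : pzRingType) : Prop :=
  left_nonsingular A /\ left_nonsingular A^c.

Definition Min (d : Order.disp_t) (X : porderType d) (P : set X) : set X :=
  [set x | P x /\ forall y, P y -> (y <= x)%O -> y = x].

Definition above_minimal (d : Order.disp_t) (X : porderType d) : set X :=
  [set y | exists2 x, Min [set: X] x & (x <= y)%O].

Arguments above_minimal {d} X.

Record incidence (d : Order.disp_t) (X : porderType d) (R : pzRingType) :=
  Incidence {
    incidence_fun :> X -> X -> R;
    incidence_supp : forall x y, ~~ (x <= y)%O -> incidence_fun x y = 0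
  }.

Section IncidenceRing.
Variables (d : Order.disp_t) (X : lfPOrderType d) (R : pzRingType).
Local Notation I := (incidence X R).
Implicit Types f g h : I.

HB.instance Definition _ := gen_eqMixin I.
HB.instance Definition _ := gen_choiceMixin I.

Lemma incidenceP f g : (forall x y, f x y = g x y) -> f = g.
Proof.
case: f g => [f pf] [g pg] /= fg.
have {}fg : f = g by apply/funext => x; apply/funext => y.
by rewrite -{}fg in pg *; rewrite (Prop_irrelevance pf pg).
Qed.

Lemma incidence0_subproof (x y : X) : ~~ (x <= y)%O -> 0 = 0 :> R.
Proof. by []. Qed.
Definition incidence0 : I := Incidence incidence0_subproof.

Lemma incidenceN_subproof f (x y : X) : ~~ (x <= y)%O -> - f x y = 0.
Proof. by move=> /incidence_supp ->; rewrite oppr0. Qed.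
Definition incidenceN f : I := Incidence (incidenceN_subproof f).

Lemma incidenceD_subproof f g (x y : X) : ~~ (x <= y)%O -> f x y + g x y = 0.
Proof. by move=> nxy; rewrite !incidence_supp // addr0. Qed.
Definition incidenceD f g : I := Incidence (incidenceD_subproof f g).

Lemma incidence1_subproof (x y : X) : ~~ (x <= y)%O -> (x == y)%:R = 0 :> R.
Proof. by case: eqVneq => // ->; rewrite lexx. Qed.
Definition incidence1 : I := Incidence incidence1_subproof.

Lemma incidenceM_subproof f g (x y : X) : ~~ (x <= y)%O ->
  \sum_(z \in [set z | (x <= z <= y)%O]) f x z * g z y = 0.
Proof.
move=> nxy; apply: fsbig1 => z /= /andP[xz zy].
by rewrite (le_trans xz zy) in nxy.
Qed.
(* Intervals are finite, so this \in-sum is the genuine sum over [x, y]. *)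
Definition incidenceM f g : I := Incidence (incidenceM_subproof f g).

Lemma incidenceM_wide f g (x y u v : X) : (u <= x)%O -> (y <= v)%O ->
  incidenceM f g x y =
  \sum_(z <- fset_set [set z | (u <= z <= v)%O]) f x z * g z y.
Proof.
move=> ux yv; rewrite -fsbig_finite; last exact: finite_interval.
apply: fsbig_widen => [z /= /andP[xz zy]|z /= [_ /negP]].
  by rewrite (le_trans ux xz) (le_trans zy yv).
rewrite negb_and => /orP[n|n]; first by rewrite incidence_supp // mul0r.
by rewrite (incidence_supp g) // mulr0.
Qed.

Lemma incidence_addrA : associative incidenceD.
Proof. by move=> f g h; apply: incidenceP => x y /=; rewrite addrA. Qed.
Lemma incidence_addrC : commutative incidenceD.
Proof. by move=> f g; apply: incidenceP => x y /=; rewrite addrC. Qed.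
Lemma incidence_add0r : left_id incidence0 incidenceD.
Proof. by move=> f; apply: incidenceP => x y /=; rewrite add0r. Qed.
Lemma incidence_addNr : left_inverse incidence0 incidenceN incidenceD.
Proof. by move=> f; apply: incidenceP => x y /=; rewrite addNr. Qed.

HB.instance Definition _ := GRing.isZmodule.Build I
  incidence_addrA incidence_addrC incidence_add0r incidence_addNr.

Lemma mem_fset_interval (x y z : X) :
  z \in fset_set [set z | (x <= z <= y)%O] -> (x <= z)%O /\ (z <= y)%O.
Proof. by rewrite in_fset_set; [rewrite inE => /andP|exact: finite_interval]. Qed.

Lemma incidence_mulrA : associative incidenceM.
Proof.
move=> f g h; apply: incidenceP => x y.
rewrite !(@incidenceM_wide _ _ x y x y) //.
transitivity (\sum_(z <- fset_set [set z | (x <= z <= y)%O])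
    \sum_(w <- fset_set [set z | (x <= z <= y)%O]) f x z * (g z w * h w y)).
  apply: eq_big_seq => z /mem_fset_interval[xz _].
  by rewrite (@incidenceM_wide g h z y x y) // big_distrr.
rewrite exchange_big; apply: eq_big_seq => w /mem_fset_interval[_ wy].
rewrite (@incidenceM_wide f g x w x y) // big_distrl.
by apply: eq_bigr => z _; rewrite mulrA.
Qed.

Lemma incidence_mul1r : left_id incidence1 incidenceM.
Proof.
move=> f; apply: incidenceP => x y /=.
have [xy|nxy] := boolP (x <= y)%O; last first.
  by rewrite (incidence_supp f) //; exact: (incidenceM_subproof incidence1 f).
rewrite -(fsbig_widen [set x]) ?fsbig_set1 ?eqxx ?mul1r //.
  by move=> _ /= ->; rewrite lexx.
by move=> z /= [_ zx]; case: eqP => [e|_]; first (by case: zx); rewrite mul0r.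
Qed.

Lemma incidence_mulr1 : right_id incidence1 incidenceM.
Proof.
move=> f; apply: incidenceP => x y /=.
have [xy|nxy] := boolP (x <= y)%O; last first.
  by rewrite (incidence_supp f) //; exact: (incidenceM_subproof f incidence1).
rewrite -(fsbig_widen [set y]) ?fsbig_set1 ?eqxx ?mulr1 //.
  by move=> _ /= ->; rewrite lexx andbT.
by move=> z /= [_ zx]; case: eqP => [e|_]; first (by case: zx); rewrite mulr0.
Qed.

Lemma incidence_mulrDl : left_distributive incidenceM incidenceD.
Proof.
move=> f g h; apply: incidenceP => x y.
rewrite -[RHS]/(incidenceM f h x y + incidenceM g h x y).
rewrite !(@incidenceM_wide _ _ x y x y) // -big_split.
by apply: eq_bigr => z _; rewrite mulrDl.
Qed.

Lemma incidence_mulrDr : right_distributive incidenceM incidenceD.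
Proof.
move=> f g h; apply: incidenceP => x y.
rewrite -[RHS]/(incidenceM f g x y + incidenceM f h x y).
rewrite !(@incidenceM_wide _ _ x y x y) // -big_split.
by apply: eq_bigr => z _; rewrite mulrDr.
Qed.

HB.instance Definition _ := GRing.Zmodule_isPzRing.Build I
  incidence_mulrA incidence_mul1r incidence_mulr1
  incidence_mulrDl incidence_mulrDr.

Definition incidence_in (J : set R) : set I :=
  [set f | forall u v, J (f u v)].

Definition row_incidence (x : X) (J : set R) : set I :=
  [set f | incidence_in J f /\ forall u v, u != x -> f u v = 0].

End IncidenceRing.

(* Main.v *)
(** Left multiplication moves row [z] of an incidence function to rows below
    [z], and never upwards.  Hence a minimal left ideal is generated by a single
    row, sitting at a minimal element [x], and there the incidence ring acts
    through [R] alone: each coordinate projection of the ideal is zero or a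
    minimal left ideal of [R].  Conversely, for [x] minimal, placing a minimal
    left ideal of [R] at a position [(x, v)] gives a minimal left ideal, and
    finiteness of the up-set of [x] writes any element of row [x] as a finite sum
    of such entries. *)

Require Import Defs.
From HB Require Import structures.
From mathcomp Require Import all_boot all_order all_algebra.
From mathcomp Require Import finmap.
From mathcomp Require Import boolp classical_sets functions cardinality fsbigop.

Local Open Scope classical_set_scope.
Local Open Scope ring_scope.

Import Order.TTheory GRing.Theory.

(** * Sums of families and minimal left ideals in an arbitrary ring *)

Section Ideals.
Local Set Implicit Arguments.
Local Unset Strict Implicit.
Variable A : pzRingType.
Implicit Types (a b : A) (J K M : set A) (F : set (set A)).

Lemma mem_family_sum F J a : F J -> J a -> family_sum F a.
Proof.
move=> FJ Ja; exists [:: a]; last by rewrite big_seq1.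
by move=> b; rewrite inE => /eqP ->; exists J.
Qed.

Lemma family_sum0 F : family_sum F 0.
Proof. by exists [::]; rewrite ?big_nil. Qed.

Lemma family_sumD F a b : family_sum F a -> family_sum F b ->
  family_sum F (a + b).
Proof.
move=> [s Fs ->] [t Ft ->]; exists (s ++ t); last by rewrite big_cat.
by move=> c; rewrite mem_cat => /orP[/Fs|/Ft].
Qed.

Lemma family_sum_sum F (T : eqType) (s : seq T) (f : T -> A) :
  (forall i, i \in s -> family_sum F (f i)) ->
  family_sum F (\sum_(i <- s) f i).
Proof.
move=> Fs; rewrite big_seq; apply: (big_ind (family_sum F)) => //.
- exact: family_sum0.
- exact: family_sumD.
Qed.

Lemma nonzero_elt J : left_ideal J -> J <> [set 0] -> exists2 a, J a & a != 0.
Proof.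
move=> [J0 _ _] nJ; apply: contrapT => no; apply: nJ; apply/seteqP; split.
  move=> a Ja /=; apply: contrapT => /eqP a0; apply: no; by exists a.
by move=> _ ->.
Qed.

Lemma principal_left_ideal a : left_ideal [set b * a | b in [set: A]].
Proof.
split; first by exists 0; rewrite ?mul0r.
  by move=> _ _ [b _ <-] [c _ <-]; exists (b + c); rewrite ?mulrDl.
by move=> b _ [c _ <-]; exists (b * c); rewrite ?mulrA.
Qed.

(** The principal left ideal of [a] lies in [M] and contains [a != 0], so minimality makes it all of
    [M]. *)
Lemma minimal_left_ideal_gen M a b : minimal_left_ideal M ->
  M a -> a != 0 -> M b -> exists c, b = c * a.
Proof.
move=> [[_ _ MM] _ minM] Ma a0 Mb.
case: (minM _ (principal_left_ideal a)) => [_ [c _ <-]|e0|eM].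
- exact: MM.
- have : [set c * a | c in [set: A]] a by exists 1; rewrite ?mul1r.
  by rewrite e0 => /= e; rewrite e eqxx in a0.
- by move: Mb; rewrite -eM => -[c _ <-]; exists c.
Qed.

End Ideals.

(** * Incidence products with one surviving term, and single-entry functions *)

Section Incidence.
Local Set Implicit Arguments.
Local Unset Strict Implicit.
Variables (d : Order.disp_t) (X : lfPOrderType d) (R : pzRingType).
Local Notation I := (incidence X R).
Implicit Types (f g h : I) (x y u v : X) (r s : R).

(** If [x] lies outside [[u, v]], one of the two factors on the right vanishes by support, so both
    sides are zero and no order assumption on [x] has to be carried around. *)
Lemma incidence_mul1term f g x u v :
  (forall z, z != x -> f u z * g z v = 0) -> (f * g) u v = f u x * g x v.
Proof.
move=> fg0; change (incidenceM f g u v = f u x * g x v).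
case: (boolP (u <= x <= v)%O) => [/andP[ux xv]|nuxv].
  rewrite /= -(fsbig_widen [set x]) ?fsbig_set1 //.
    by move=> _ /= ->; rewrite ux.
  by move=> z /= [_ /eqP]; exact: fg0.
have -> : f u x * g x v = 0.
  move: nuxv; rewrite negb_and => /orP[n|n].
    by rewrite incidence_supp ?mul0r.
  by rewrite (incidence_supp g) ?mulr0.
apply: fsbig1 => z /=; case: (eqVneq z x) => [->|zx _]; last exact: fg0.
by rewrite (negPf nuxv).
Qed.

Lemma incidence_mul_row f g x u v :
  (forall z w, z != x -> g z w = 0) -> (f * g) u v = f u x * g x v.
Proof. by move=> g0; apply: incidence_mul1term => z /g0 ->; rewrite mulr0. Qed.

Lemma incidence_sumE (T : Type) (s : seq T) (F : T -> I) u v :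
  (\sum_(i <- s) F i) u v = \sum_(i <- s) F i u v.
Proof. exact: (big_morph (fun f : I => f u v)). Qed.

Lemma single_subproof x y r u v : ~~ (u <= v)%O ->
  (if [&& (x <= y)%O, u == x & v == y] then r else 0) = 0.
Proof.
by case: and3P => // -[xy /eqP -> /eqP ->]; rewrite xy.
Qed.

(* Zero unless [x <= y]. *)
Definition single x y r : I := Incidence (single_subproof x y r).

Lemma single_out x y r u v : u != x -> single x y r u v = 0.
Proof. by move=> /negPf /= ->; rewrite andbF. Qed.

Lemma single_diag x y r : (x <= y)%O -> single x y r x y = r.
Proof. by rewrite /= !eqxx => ->. Qed.

Lemma single_inj x y : (x <= y)%O -> injective (single x y).
Proof. by move=> xy r s e; rewrite -(single_diag r xy) e single_diag. Qed.

Lemma single0 x y : single x y 0 = 0.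
Proof. by apply: incidenceP => u v /=; case: ifP. Qed.

Lemma singleD x y r s : single x y (r + s) = single x y r + single x y s.
Proof. by apply: incidenceP => u v /=; case: ifP; rewrite ?addr0. Qed.

Lemma single_mul x y r f v : (x <= y)%O -> (single x y r * f) x v = r * f y v.
Proof.
move=> xy; rewrite (@incidence_mul1term _ _ y) ?single_diag // => z /negPf /= ->.
by rewrite !andbF mul0r.
Qed.

Lemma single_mul_out x y r f u v : u != x -> (single x y r * f) u v = 0.
Proof.
by move=> ux; rewrite (@incidence_mul1term _ _ y) ?single_out ?mul0r // => z _;
  rewrite single_out ?mul0r.
Qed.

(** Only column [x] of [f] meets row [x] of the second factor, and since nothing lies strictly below
    [x], that column is zero off the diagonal. *)
Lemma mul_single_min f x y r : Min [set: X] x ->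
  f * single x y r = single x y (f x x * r).
Proof.
move=> [_ minx]; apply: incidenceP => u v.
rewrite (@incidence_mul_row _ _ x) => [|z w]; last exact: single_out.
have [-> /=|ux] := eqVneq u x.
  by rewrite eqxx; case: ifP; rewrite ?mulr0.
rewrite (single_out _ _ _ ux) incidence_supp ?mul0r //.
by apply: contra ux => /minx ->.
Qed.

(** * From the socle of [R] to the socle of the incidence ring *)

(** By [mul_single_min] the incidence ring acts on [single x y r] by multiplying [r] with the scalar
    [f x x], so left ideals inside the image correspond to left ideals inside [L]. *)
Lemma minimal_left_ideal_single x y (L : set R) : Min [set: X] x ->
  (x <= y)%O -> minimal_left_ideal L ->
  minimal_left_ideal [set single x y r | r in L].
Proof.
move=> minx xy [[L0 LD LM] nL minL]; split.
- split; first by exists 0; rewrite ?single0.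
    by move=> _ _ [r Lr <-] [s Ls <-]; exists (r + s); rewrite ?singleD //; apply: LD.
  move=> f _ [r Lr <-]; exists (f x x * r); first exact: LM.
  by rewrite mul_single_min.
- have [r Lr r0] := nonzero_elt (And3 L0 LD LM) nL.
  move=> e; have : [set single x y r | r in L] (single x y r) by exists r.
  rewrite e /= -(single0 x y) => /(single_inj xy) e0.
  by rewrite e0 eqxx in r0.
move=> J [J0 JD JM] JL; pose K := [set r | J (single x y r)].
have KL : K `<=` L by move=> r /JL[s Ls /(single_inj xy) <-].
have idK : left_ideal K.
  split=> [|r s Kr Ks|r s Ks]; rewrite /K /= ?single0 ?singleD //.
    exact: JD.
  (* Every scalar [r] of [R] is realised as a diagonal value, by [single x x r]. *)
  have := JM (single x x r) _ Ks.
  by rewrite mul_single_min // single_diag.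
case: (minL K idK KL) => eK; [left|right]; apply/seteqP; split.
- move=> f Jf; have [r Lr rf] := JL _ Jf.
  have : K r by rewrite /K /= rf.
  by rewrite eK /= => r0; rewrite -rf r0 single0.
- by move=> _ ->.
- exact: JL.
- by move=> _ [r Lr <-]; move: Lr; rewrite -eK.
Qed.

Lemma left_socle_single x y r : Min [set: X] x -> (x <= y)%O ->
  left_socle R r -> left_socle I (single x y r).
Proof.
move=> minx xy [s Ls ->].
rewrite (big_morph _ (singleD x y) (single0 x y)).
apply: family_sum_sum => b /Ls[L minL Lb].
apply: mem_family_sum (minimal_left_ideal_single minx xy minL) _.
by exists b.
Qed.

Lemma row_incidence_sub_socle x : Min [set: X] x ->
  finite_set [set y | (x <= y)%O] ->
  row_incidence x (left_socle R) `<=` left_socle I.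
Proof.
move=> minx finx f [fS f0].
(* Row [x] is supported on the finite up-set of [x], so [f] is the finite sum of its entries. *)
have -> : f = \sum_(y <- fset_set [set y | (x <= y)%O]) single x y (f x y).
  apply: incidenceP => u v; rewrite incidence_sumE.
  have [->|ux] := eqVneq u x; last first.
    by rewrite f0 // big1 // => y _; rewrite single_out.
  have [xv|nxv] := boolP (x <= v)%O; last first.
    by rewrite incidence_supp // big1 // => y _; rewrite incidence_supp.
  rewrite (big_fsetD1 v) /=; last by rewrite in_fset_set // inE.
  rewrite xv !eqxx /= big1_fset ?addr0 // => y.
  by rewrite !inE eq_sym => /andP[/negPf -> _]; rewrite !andbF.
apply: family_sum_sum => y; rewrite in_fset_set // inE /= => xy.
exact: left_socle_single.
Qed.

(** * From minimal left ideals of the incidence ring back to [R] *)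

Lemma minimal_left_ideal_row (M : set I) : minimal_left_ideal M ->
  exists2 x, Min [set: X] x & forall f, M f -> forall u v, u != x -> f u v = 0.
Proof.
move=> minM; have [idM nM _] := minM; have [_ _ MM] := idM.
have [f Mf f0] := nonzero_elt idM nM.
have [x [v fxv]] : exists x v, f x v != 0.
  apply: contrapT => no; move/eqP: f0; apply; apply: incidenceP => u w /=.
  by apply: contrapT => /eqP fuw; apply: no; exists u, w.
(* Multiplying by [single w x 1] copies row [x] of [f] to row [w]. The copy is nonzero at [(w, v)],
   hence generates [M]. Below, a general [w <= x] shows that [x] is minimal, and [w = x] confines
   [M] to row [x]. *)
have gen w h : (w <= x)%O -> M h -> exists c : I, forall p q, h p q = c p w * f x q.
  move=> wx Mh; have Mwf := MM (single w x 1) f Mf.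
  have wf0 : single w x 1 * f != 0.
    apply/eqP => /(congr1 (fun k : I => k w v)).
    by rewrite single_mul // mul1r => /eqP; rewrite (negPf fxv).
  have [c ->] := minimal_left_ideal_gen minM Mwf wf0 Mh.
  exists c => p q; rewrite (@incidence_mul_row _ _ w) ?single_mul ?mul1r //.
  by move=> z r zw; rewrite single_mul_out.
have minx : Min [set: X] x.
  (* Taking [h = f] gives [f x v = c x w * f x v], which is nonzero only if [x <= w]. *)
  split=> // w _ wx; have [c fE] := gen w f wx Mf.
  apply: le_anti; rewrite wx /=; apply: contraT => nxw.
  by rewrite fE incidence_supp // mul0r eqxx in fxv.
exists x => // h Mh u w ux; have [c ->] := gen x h (lexx x) Mh.
rewrite incidence_supp ?mul0r //; apply: contra ux => ux.
by rewrite (minx.2 u).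
Qed.

(** Evaluation at [(x, y)] turns the action of [g] on [M] into multiplication by [g x x], so it
    behaves like a linear map out of a simple module: its image is zero or simple. *)
Lemma minimal_left_ideal_entry (M : set I) x y :
  minimal_left_ideal M ->
  (forall f, M f -> forall u v, u != x -> f u v = 0) ->
  [set f x y | f in M] = [set 0] \/ minimal_left_ideal [set f x y | f in M].
Proof.
move=> [[M0 MD MM] _ minM] Mrow; have [->|nN] := pselect ([set f x y | f in M] = [set 0]).
  by left.
have row g f : M f -> (g * f) x y = g x x * f x y.
  by move=> Mf; apply: incidence_mul_row; exact: Mrow.
right; split=> //.
  split; first by exists 0.
    by move=> _ _ [f Mf <-] [g Mg <-]; exists (f + g) => //; exact: MD.
  move=> r _ [f Mf <-]; exists (single x x r * f); first exact: MM.
  by rewrite single_mul.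
(* [J] is the preimage of [K] in [M]; minimality of [M] makes it zero or everything, and [K] is its
   image. *)
move=> K [K0 KD KM] KN; pose J := [set f | M f /\ K (f x y)].
have idJ : left_ideal J.
  split=> [//|f g [Mf Kf] [Mg Kg]|g f [Mf Kf]].
    by split; [exact: MD|exact: KD].
  by split; [exact: MM|rewrite row //; exact: KM].
case: (minM J idJ) => [f []//|eJ|eJ]; [left|right]; apply/seteqP; split=> //.
- move=> k Kk; have [f Mf fk] := KN _ Kk.
  have : J f by split; rewrite ?fk.
  by rewrite eJ /= -fk => ->.
- by move=> _ ->.
- by move=> _ [f Mf <-]; move: Mf; rewrite -eJ => -[].
Qed.

Lemma minimal_left_ideal_sub_row (M : set I) : minimal_left_ideal M ->
  exists2 x, Min [set: X] x & M `<=` row_incidence x (left_socle R).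
Proof.
move=> minM; have [x minx Mrow] := minimal_left_ideal_row minM.
exists x => // f Mf; split; last exact: Mrow.
move=> u v; have [->|ux] := eqVneq u x; last first.
  by rewrite (Mrow f) //; exact: family_sum0.
have Nf : [set g x v | g in M] (f x v) by exists f.
have [N0|minN] := minimal_left_ideal_entry v minM Mrow.
  by move: Nf; rewrite N0 /= => ->; exact: family_sum0.
exact: mem_family_sum minN Nf.
Qed.

(** * Independence of the rows, and assembly *)

Lemma row_incidence_direct (D : set X) (J : set R) : J 0 ->
  direct_family D (fun x => row_incidence x J).
Proof.
move=> J0 x Dx; apply/seteqP; split=> [f [[_ f0] [s Fs fE]]|_ ->] /=.
  apply: incidenceP => u v; have [->|ux] := eqVneq u x; last exact: f0.
  rewrite fE incidence_sumE big_seq big1 // => b /Fs[_ [y [_ yx] <-] [_ b0]].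
  by apply: b0; apply/eqP => xy; apply: yx.
by split; [split|exact: family_sum0].
Qed.

End Incidence.

Lemma Min_above_minimal (d : Order.disp_t) (X : porderType d) :
  Min (above_minimal X) = Min [set: X].
Proof.
apply/seteqP; split=> x [].
  (* The minimal [m] below [x] lies above itself, hence in [above_minimal X], and so equals [x]. *)
  move=> [m minm mx] minx; rewrite -(minx m) //.
  by exists m.
move=> _ minx; split; last by move=> y _; exact: minx.
by exists x.
Qed.

Theorem theorem3p0p8 (d : Order.disp_t) (X : lfPOrderType d) (R : pzRingType)
    (artR : artinian R) (nsR : nonsingular R)
    (finMin : finite_set (Min (above_minimal X)))
    (fin_kappa : forall x : X, finite_set [set y | (x <= y)%O]) :
  internal_direct_sum (Min (above_minimal X))
    (fun x => row_incidence x (left_socle R))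
    (left_socle (incidence X R)).
Proof.
rewrite Min_above_minimal; split; last first.
  by apply: row_incidence_direct; exact: family_sum0.
apply/seteqP; split=> _ [s Fs ->].
  (* The same list of summands works, since each minimal left ideal sits inside one row. *)
  exists s => // b /Fs[M /minimal_left_ideal_sub_row[x minx Mx] Mb].
  exists (row_incidence x (left_socle R)); last exact: Mx.
  by exists x.
apply: family_sum_sum => b /Fs[_ [x minx <-]].
exact: row_incidence_sub_socle.
Qed.
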